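(* There are absolute constants $K_0,c,C>0$ such that the following holds. Let $n,d\ge1$ be integers, let $0<s\le c\sqrt n$, and assume $\mathcal I_{n,d}(s)\ge1$. Then there are independent random variables $X_1,\ldots,X_n$ with $\mathbb{E}X_i=0$, $\mathbb{E}X_i^2=1$, $\|X_i\|_{\psi_2}\le K_0$, and a convex $1$-Lipschitz function $f:H_d\to\mathbb{R}$ such that, with $X=(X_1,\ldots,X_n)$, for every $m\in\mathbb{R}$, $$\mathbb{P}\left\{|f(X^{\otimes d})-m|\ge c\,n^{(d-1)/2}s\right\}\ge\exp\big(-C\,\mathcal I_{n,d}(s)\big).$$
   Context: $H_d=(\mathbb{R}^n)^{\otimes d}$ is the Hilbert-space tensor product of $d$ copies of Euclidean $\mathbb{R}^n$, with its Hilbert norm; Lipschitz is with respect to this norm. $X^{\otimes d}=X\otimes\cdots\otimes X$ ($d$ factors). $\|W\|_{\psi_2}=\inf\{a>0:\mathbb{E}\exp(W^2/a^2)\le 2\}$. For $s>0$, $$\mathcal I_{n,d}(s)=\min\left\{\frac{s^2}{d^2},\ \frac{s^2}{d\log(e+nd/s^2)}\right\}.$$ *)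

(* Defs.v *)
From mathcomp Require Import all_boot all_order all_algebra.
From mathcomp Require Import all_classical all_reals all_analysis.

Set Implicit Arguments.
Unset Strict Implicit.
Unset Printing Implicit Defensive.

Import Order.TTheory GRing.Theory Num.Theory.
Import numFieldNormedType.Exports.

Local Open Scope classical_set_scope.
Local Open Scope ring_scope.

(* (R^n)^{(x) d} in coordinates: u i is the coefficient of u on the basis
   tensor e_(i 0) (x) ... (x) e_(i (d-1)).  The Hilbert tensor product makes
   these basis tensors orthonormal, whence hdot and hnorm; hdot_tens below is
   the defining identity <(x)_k x_k, (x)_k y_k> = prod_k <x_k, y_k>. *)
Definition tensor_space (R : realType) (n d : nat) : Type :=
  {ffun {ffun 'I_d -> 'I_n} -> R^o}.

Definition hdot (R : realType) (n d : nat) (u v : tensor_space R n d) : R :=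
  \sum_i u i * v i.

Definition hnorm (R : realType) (n d : nat) (u : tensor_space R n d) : R :=
  Num.sqrt (hdot u u).

Definition tens (R : realType) (n d : nat) (x : 'I_d -> 'rV[R]_n) :
    tensor_space R n d :=
  [ffun i : {ffun 'I_d -> 'I_n} => \prod_(k < d) x k ord0 (i k)].

Definition tens_pow (R : realType) (n d : nat) (x : 'rV[R]_n) :
    tensor_space R n d :=
  tens (fun _ : 'I_d => x).

Lemma hdot_tens (R : realType) (n d : nat) (x y : 'I_d -> 'rV[R]_n) :
  hdot (tens x) (tens y) =
  \prod_(k < d) \sum_(j < n) x k ord0 j * y k ord0 j.
Proof.
rewrite bigA_distr_bigA; apply: eq_bigr => i _.
by rewrite !ffunE -big_split.
Qed.

Definition lipschitz1 (R : realType) (n d : nat) (f : tensor_space R n d -> R)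
    : Prop :=
  forall u v, `|f u - f v| <= hnorm (u - v).

Section probability_notions.
Context (disp : measure_display) (T : measurableType disp) (R : realType).
Variable P : probability T R.

(* The infimum is taken in \bar R, so that it is +oo when no a is admissible. *)
Definition psi2_norm (W : T -> R) : \bar R :=
  ereal_inf [set a%:E | a in
    [set a : R | 0 < a /\
      ('E_P[fun w => (expR (W w ^+ 2 / a ^+ 2))%R] <= 2%:E)%E]].

Definition mutually_independent (n : nat) (X : 'I_n -> {RV P >-> R}) : Prop :=
  forall (J : {set 'I_n}) (A : 'I_n -> set R),
    (forall i, measurable (A i)) ->
    P [set w | forall i, i \in J -> A i (X i w)] =
    (\prod_(i in J) P (X i @^-1` A i))%E.

Definition random_vector (n : nat) (X : 'I_n -> {RV P >-> R}) (w : T) :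
    'rV[R]_n :=
  \row_i X i w.

End probability_notions.

Definition rate (R : realType) (n d : nat) (s : R) : R :=
  Num.min (s ^+ 2 / d%:R ^+ 2)
          (s ^+ 2 / (d%:R * ln (expR 1 + n%:R * d%:R / s ^+ 2))).

(* Main.v *)
From HB Require Import structures.
Require Import Defs.
From mathcomp Require Import all_boot all_order all_algebra.
From mathcomp Require Import all_classical all_reals all_analysis.
From mathcomp Require Import measurable_realfun ring lra.

Set Implicit Arguments.
Unset Strict Implicit.
Unset Printing Implicit Defensive.

Import Order.TTheory GRing.Theory Num.Theory.
Import numFieldNormedType.Exports.

Local Open Scope classical_set_scope.
Local Open Scope ring_scope.

(** The variables are symmetric and take two absolute values: |X_i| is M with
probability p and a otherwise, with (1 - p) a^2 + p M^2 = 1.  The functional is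
the Euclidean distance f to a cube [-tau, tau]^(n^d), which is convex and
1-Lipschitz.  Since f (X^(x)d) depends on the X_i through their absolute values
only, it is governed by the number N of coordinates with |X_i| = M.  If f takes
values below lo and above hi with probability at least pr each and
hi - lo >= 2 delta, then every real m is at distance at least delta from one
of these two ranges, so that f deviates from m by delta with probability at
least pr (two_level_deviation).
It remains to choose p, a, M and tau so that a fluctuation of the binomial
variable N that costs exp (- C I) moves f by a multiple of n^((d-1)/2) s.
Let L = ln (e + n d / s^2).

If I = s^2 / d^2, take p = 1/2 and tau = 0.  Then f (X^(x)d) = |X|^d, the
Euclidean norm |X| exceeds sqrt n by t = s / d with probability at least
exp (- C t^2), and raising to the power d multiplies the gap by about
d n^((d-1)/2) (norm_deviates).

If I = k := s^2 / (d L), then d <= L; take n p = k, M^2 = L and tau = a^d.  An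
entry of X^(x)d leaves the cube exactly when its multi-index meets the set of
the N large coordinates.  There are about d N n^(d-1) such multi-indices, and
most of them meet it once and carry an entry of size about M, so that f^2 is of
order d L N n^(d-1) = (N / k) s^2 n^(d-1).  As N is nearly Poisson of mean k,
going from N <= 4 k to N >= 400 k costs exp (- C k) (spike_deviates).  The
value M^2 = L is, up to a constant, the largest that keeps the X_i uniformly
sub-Gaussian: p exp L is about 1 / L.

Both tails of N come from the single identity
E exp (l N) = (1 + p (exp l - 1))^n: the upper one by the second moment
inequality of Paley and Zygmund applied to exp (l N), the lower one by the
inequality of Markov. *)

(** * Finite probability spaces *)

(** The point t0 is a parameter because measurable types are pointed. *)
Definition discrete (T : finType) (t0 : T) : Type := T.
HB.instance Definition _ (T : finType) (t0 : T) := Finite.on (discrete t0).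
HB.instance Definition _ (T : finType) (t0 : T) :=
  isPointed.Build (discrete t0) t0.
HB.instance Definition _ (T : finType) (t0 : T) :=
  @isMeasurable.Build default_measure_display (discrete t0)
    discrete_measurable discrete_measurable0
    discrete_measurableC discrete_measurableU.

Lemma finite_probability (R : realType) (T : finType) (t0 : T) (w : T -> R) :
    (forall t, 0 <= w t) -> \sum_t w t = 1 ->
  exists P : probability (discrete t0) R,
    (forall f : discrete t0 -> R, ('E_P[f] = (\sum_t w t * f t)%:E)%E) /\
    forall A : set (discrete t0), P A = (\sum_t w t * \1_A t)%:E.
Proof.
move=> w0 w1.
pose x k : discrete t0 := nth t0 (enum T) k.
pose m k : {measure set (discrete t0) -> \bar R} :=
  mscale (NngNum (w0 (x k))) (dirac (x k)).
have mE (f : discrete t0 -> R) :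
    \sum_(k < #|T|) w (x k) * f (x k) = \sum_t w t * f t.
  rewrite -[RHS]big_enum (big_nth t0) -cardE big_mkord.
  by apply: eq_bigl => i.
have mT : msum m #|T| setT = 1%E.
  rewrite /msum /m /= /mscale /=.
  under eq_bigr do rewrite diracT -EFinM.
  by rewrite sumEFin (mE (fun=> 1)) (eq_bigr w) ?w1// => i _; rewrite mulr1.
pose P : probability (discrete t0) R :=
  HB.pack (msum m #|T|) (Measure_isProbability.Build _ _ _ (msum m #|T|) mT).
have mfn (f : discrete t0 -> \bar R) :
    measurable_fun [set: discrete t0] f by [].
have int0 (f : discrete t0 -> \bar R) : (forall t, 0 <= f t)%E ->
    (\int[P]_t f t = \sum_t (w t)%:E * f t)%E.
  move=> f0; rewrite ge0_integral_measure_sum//.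
  rewrite -[RHS]big_enum (big_nth t0) -cardE big_mkord.
  apply: eq_big => [i//|i _].
  by rewrite ge0_integral_mscale//= integral_dirac// diracT mul1e.
have EE (f : discrete t0 -> R) : ('E_P[f] = (\sum_t w t * f t)%:E)%E.
  rewrite unlock integralE int0// int0//.
  under eq_bigr do rewrite funeposE /= -EFin_max -EFinM.
  under [X in (_ - X)%E]eq_bigr do rewrite funenegE /= -EFin_max -EFinM.
  rewrite !sumEFin -EFinB; congr _%:E; rewrite -sumrB; apply: eq_bigr => t _.
  rewrite -mulrBr; congr (_ * _); have [f0|f0] := leP 0 (f t).
    by rewrite (max_idPr _) ?oppr_le0// subr0.
  by rewrite (max_idPl _) ?oppr_ge0 ?ltW// sub0r opprK.
exists P; split=> // A.
by rewrite -(expectation_indic P)// EE.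
Qed.

Lemma sum_prod_ffun (R : comNzRingType) (I V : finType) (g : V -> R)
    (F : I -> V -> R) :
  \sum_(w : {ffun I -> V}) (\prod_i g (w i)) * (\prod_i F i (w i)) =
  \prod_i \sum_v g v * F i v.
Proof.
by rewrite bigA_distr_bigA; apply: eq_bigr => w _; rewrite big_split.
Qed.

(** The last component reduces every probability below to a finite sum over
[{ffun 'I_n -> V}], where w t is the list of the values that were drawn. *)
Lemma iid_model (R : realType) (V : finType) (v0 : V) (n : nat)
    (g phi : V -> R) : (forall v, 0 <= g v) -> \sum_v g v = 1 ->
  exists (disp : measure_display) (T : measurableType disp)
         (P : probability T R) (X : 'I_n -> {RV P >-> R})
         (w : T -> {ffun 'I_n -> V}),
    [/\ (forall A : set T, measurable A), mutually_independent X,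
        forall i t, X i t = phi (w t i),
        forall i (h : R -> R), ('E_P[fun t => h (X i t)] =
                                (\sum_v g v * h (phi v))%:E)%E
      & forall Q : pred {ffun 'I_n -> V},
          P [set t | Q (w t)] = (\sum_(u | Q u) \prod_i g (u i))%:E].
Proof.
move=> g0 g1.
have W0 (u : {ffun 'I_n -> V}) : 0 <= \prod_i g (u i) by exact: prodr_ge0.
have W1 : \sum_(u : {ffun 'I_n -> V}) \prod_i g (u i) = 1.
  transitivity (\prod_(i < n) \sum_v g v * 1).
    rewrite -sum_prod_ffun; apply: eq_bigr => u _.
    by rewrite [X in _ * X]big1 ?mulr1.
  apply: big1 => i _.
  by rewrite -[RHS]g1; apply: eq_bigr => v _; rewrite mulr1.
have [P [PE PA]] := finite_probability [ffun=> v0] W0 W1.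
pose T : measurableType _ := discrete [ffun _ : 'I_n => v0].
have mX i : measurable_fun [set: T] (fun t : T => phi (t i)) by [].
pose X i : {RV P >-> R} :=
  HB.pack (fun t : T => phi (t i)) (isMeasurableFun.Build _ _ T R _ (mX i)).
have marginal i (h : R -> R) :
    ('E_P[fun t => h (X i t)] = (\sum_v g v * h (phi v))%:E)%E.
  rewrite PE; congr _%:E.
  (* h (X i) is a product of functions of single coordinates *)
  pose F j v := if j == i then h (phi v) else 1.
  transitivity (\prod_j \sum_v g v * F j v).
    rewrite -sum_prod_ffun; apply: eq_bigr => u _; congr (_ * _).
    rewrite (bigD1 i)//= /F eqxx big1 ?mulr1// => j /negbTE ->//.
  rewrite (bigD1 i)//= /F eqxx [X in _ * X]big1 ?mulr1// => j /negbTE ->.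
  by rewrite -[RHS]g1; apply: eq_bigr => v _; rewrite mulr1.
exists default_measure_display, T, P, X, id; split=> //.
- move=> J A mA.
  have PXA i : P (X i @^-1` A i) = (\sum_v g v * \1_(A i) (phi v))%:E.
    by rewrite -(marginal i) -expectation_indic.
  rewrite PA.
  under [RHS]eq_bigr do rewrite PXA.
  rewrite prodEFin; congr _%:E.
  pose F i v : R := if i \in J then \1_(A i) (phi v) else 1.
  transitivity (\prod_i \sum_v g v * F i v).
    rewrite -sum_prod_ffun; apply: eq_bigr => u _; congr (_ * _).
    rewrite /F -big_mkcond/= indicE.
    have [uA|uA] := boolP (_ \in _).
      rewrite big1// => i iJ; rewrite indicE mem_set//.
      by move: uA; rewrite inE; apply.
    suff [i iJ nA] : exists2 i, i \in J & ~ A i (phi (u i)).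
      by rewrite (bigD1 i)//= indicE memNset ?mul0r.
    apply: contrapT => H; move/negP: uA; apply; rewrite inE => i iJ /=.
    by apply: contrapT => nA; apply: H; exists i.
  rewrite [RHS]big_mkcond; apply: eq_bigr => i _; rewrite /F; case: ifP => // _.
  by rewrite -[RHS]g1; apply: eq_bigr => v _; rewrite mulr1.
- move=> Q; rewrite PA; congr _%:E; rewrite [RHS]big_mkcond.
  apply: eq_bigr => u _; rewrite indicE; case: ifPn => Qu.
    by rewrite mem_set ?mulr1.
  by rewrite memNset ?mulr0//; apply/negP.
Qed.

(** * Tails of a binomial variable *)

(** The values of Y below half its mean m contribute at most m / 2 to m, so
those above it contribute at least m / 2.  Young's inequality in the form
Y <= m Y^2 / (4 m2) + m2 / m, with m2 the second moment, bounds the latter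
contribution by m / 4 + (m2 / m) Q, where Q is the probability sought. *)
Lemma paley_zygmund (R : realType) (T : finType) (w Y : T -> R) :
    (forall t, 0 <= w t) -> \sum_t w t = 1 ->
    0 < \sum_t w t * Y t -> 0 < \sum_t w t * Y t ^+ 2 ->
  (\sum_t w t * Y t) ^+ 2 / (4 * \sum_t w t * Y t ^+ 2) <=
  \sum_(t | (\sum_t w t * Y t) / 2 <= Y t) w t.
Proof.
move=> w0 w1; set m := \sum_t w t * Y t; set m2 := \sum_t w t * Y t ^+ 2.
move=> m_gt0 m2_gt0; set Q := \sum_(t | _) w t.
have small : \sum_(t | ~~ (m / 2 <= Y t)) w t * Y t <= m / 2.
  have mE : \sum_t w t * (m / 2) = m / 2 by rewrite -mulr_suml w1 mul1r.
  rewrite -[leRHS]mE.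
  rewrite [leRHS](bigID (fun t => m / 2 <= Y t))/=.
  rewrite ler_wpDl//.
    by apply: sumr_ge0 => t _; rewrite mulr_ge0// divr_ge0// ltW.
  by apply: ler_sum => t; rewrite -ltNge => /ltW; exact: ler_wpM2l.
have large : \sum_(t | m / 2 <= Y t) w t * Y t <= m / 4 + m2 / m * Q.
  apply: (@le_trans _ _ (\sum_(t | m / 2 <= Y t)
      w t * (m / (4 * m2) * Y t ^+ 2 + m2 / m))).
    apply: ler_sum => t _; apply: ler_wpM2l => //; rewrite -subr_ge0.
    have -> : m / (4 * m2) * Y t ^+ 2 + m2 / m - Y t =
        (m * Y t - 2 * m2) ^+ 2 / (4 * m2 * m).
      by field; rewrite !gt_eqF.
    by rewrite divr_ge0 ?sqr_ge0// !mulr_ge0// ltW.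
  under eq_bigr do rewrite mulrDr mulrCA.
  rewrite big_split/= -mulr_sumr -mulr_suml [Q * _]mulrC lerD2r.
  have -> : m / 4 = m / (4 * m2) * m2 by field; rewrite gt_eqF.
  apply: ler_wpM2l; first by rewrite divr_ge0 ?mulr_ge0// ltW.
  rewrite /m2 [leRHS](bigID (fun t => m / 2 <= Y t))/= lerDl.
  by apply: sumr_ge0 => t _; rewrite mulr_ge0 ?sqr_ge0.
have : m <= m / 2 + (m / 4 + m2 / m * Q).
  rewrite {1}/m (bigID (fun t => m / 2 <= Y t))/= addrC.
  exact: lerD.
rewrite ler_pdivrMr ?mulr_gt0// => H.
have : m / 4 <= m2 / m * Q by lra.
rewrite mulrAC ler_pdivlMr// => {}H; nra.
Qed.

Lemma markov_half (R : realType) (T : finType) (w Y : T -> R) :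
    (forall t, 0 <= w t) -> \sum_t w t = 1 -> (forall t, 0 <= Y t) ->
    0 < \sum_t w t * Y t ->
  1 / 2 <= \sum_(t | Y t <= 2 * \sum_t w t * Y t) w t.
Proof.
move=> w0 w1 Y0; set m := \sum_t w t * Y t => m_gt0.
have : \sum_(t | ~~ (Y t <= 2 * m)) w t <= 1 / 2.
  have -> : 1 / 2 = (\sum_t w t * Y t) / (2 * m).
    by rewrite -/m; field; rewrite gt_eqF.
  rewrite mulr_suml [leRHS](bigID (fun t => Y t <= 2 * m))/= ler_wpDl//.
    by apply: sumr_ge0 => t _; rewrite divr_ge0 ?mulr_ge0// ltW.
  apply: ler_sum => t; rewrite -ltNge => /ltW Yt.
  by rewrite ler_pdivlMr ?mulr_gt0// ler_wpM2l.
move: w1; rewrite (bigID (fun t => Y t <= 2 * m))/=; lra.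
Qed.

Section binomial_count.
Variables (R : realType) (n : nat) (p : R).
Hypotheses (p_ge0 : 0 <= p) (p_le1 : p <= 1).

(** The first boolean tells whether the coordinate is large; the second one is
its sign. *)
Definition coin (v : bool * bool) : R := (if v.1 then p else 1 - p) / 2.

Definition heads (u : {ffun 'I_n -> bool * bool}) : {set 'I_n} :=
  [set i | (u i).1].

Definition bern_mgf (l : R) : R := 1 + p * (expR l - 1).

Lemma sum_coin (h : bool * bool -> R) :
  \sum_v coin v * h v =
  p * ((h (true, true) + h (true, false)) / 2) +
  (1 - p) * ((h (false, true) + h (false, false)) / 2).
Proof.
transitivity (\sum_b \sum_c coin (b, c) * h (b, c)).
  by rewrite pair_bigA; apply: eq_bigr => -[].
by rewrite !big_bool /coin/=; field.
Qed.

Lemma coin_ge0 v : 0 <= coin v.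
Proof. by rewrite /coin divr_ge0//; case: ifP => // _; rewrite subr_ge0. Qed.

Lemma sum_coin1 : \sum_v coin v = 1.
Proof.
rewrite (eq_bigr (fun v => coin v * 1)) => [|v _]; last by rewrite mulr1.
by rewrite sum_coin; field.
Qed.

Lemma prod_coin_ge0 (u : {ffun 'I_n -> bool * bool}) : 0 <= \prod_i coin (u i).
Proof. by apply: prodr_ge0 => i _; exact: coin_ge0. Qed.

Lemma heads_mgf (l : R) :
  \sum_(u : {ffun 'I_n -> bool * bool})
    (\prod_i coin (u i)) * expR (l * #|heads u|%:R) = bern_mgf l ^+ n.
Proof.
transitivity (\prod_(i < n) \sum_v coin v * (if v.1 then expR l else 1)).
  rewrite -sum_prod_ffun; apply: eq_bigr => u _; congr (_ * _).
  rewrite expRM_natr -big_mkcond/= -prodr_const.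
  by apply: eq_bigl => i; rewrite inE.
by rewrite prodr_const card_ord sum_coin /= /bern_mgf; congr (_ ^+ n); field.
Qed.

Lemma sum_prod_coin :
  \sum_(u : {ffun 'I_n -> bool * bool}) \prod_i coin (u i) = 1.
Proof.
transitivity (bern_mgf 0 ^+ n).
  by rewrite -heads_mgf; apply: eq_bigr => u _; rewrite mul0r expR0 mulr1.
by rewrite /bern_mgf expR0 subrr mulr0 addr0 expr1n.
Qed.

Lemma bern_mgf_gt0 (l : R) : 0 < bern_mgf l.
Proof.
have -> : bern_mgf l = (1 - p) + p * expR l by rewrite /bern_mgf; ring.
move: p_ge0; rewrite le_eqVlt => /predU1P[<-|p_gt0].
  by rewrite subr0 mul0r addr0.
by rewrite ltr_wpDl ?subr_ge0// mulr_gt0 ?expR_gt0.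
Qed.

(** With z = exp l - 1, the ratio E[Y]^2 / E[Y^2] for Y = exp (l N) is the n-th
power of (1 + p z)^2 / (1 + p (2 z + z^2)), which is at least 1 - p z^2, hence
at least exp (- 2 p z^2) when p z^2 <= 1/2. *)
Lemma heads_upper_tail (l : R) : 0 <= l -> p * (expR l - 1) ^+ 2 <= 1 / 2 ->
  expR (- (2 * (n%:R * (p * (expR l - 1) ^+ 2)))) / 4 <=
  \sum_(u : {ffun 'I_n -> bool * bool} |
      bern_mgf l ^+ n / 2 <= expR (l * #|heads u|%:R)) \prod_i coin (u i).
Proof.
move=> l0; set x := p * _ => x_le.
have m2E : \sum_(u : {ffun 'I_n -> bool * bool})
    (\prod_i coin (u i)) * expR (l * #|heads u|%:R) ^+ 2 =
    bern_mgf (2 * l) ^+ n.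
  rewrite -heads_mgf; apply: eq_bigr => u _.
  by rewrite -expRM_natl mulrA.
have := @paley_zygmund R _ _ (fun u => expR (l * #|heads u|%:R))
  prod_coin_ge0 sum_prod_coin.
rewrite m2E heads_mgf => /(_ (exprn_gt0 _ (bern_mgf_gt0 _))).
move=> /(_ (exprn_gt0 _ (bern_mgf_gt0 _))); apply: le_trans.
rewrite -exprM mulnC exprM invfM [4^-1 * _]mulrC [leRHS]mulrA.
rewrite ler_wpM2r// -exprVn -exprMn.
have -> : - (2 * (n%:R * x)) = n%:R * (- (2 * x)) by ring.
rewrite expRM_natl; apply: lerXn2r; rewrite ?nnegrE ?expR_ge0//.
  by rewrite divr_ge0 ?sqr_ge0// ltW// bern_mgf_gt0.
rewrite ler_pdivlMr ?bern_mgf_gt0//.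
have x_ge0 : 0 <= x by rewrite mulr_ge0 ?sqr_ge0.
have exp_le : expR (- (2 * x)) <= 1 - x.
  have x1 : 0 < 1 - x by lra.
  rewrite expRN -[leRHS]invrK lef_pV2 ?posrE ?expR_gt0 ?invr_gt0//.
  apply: le_trans (expR_ge1Dx _); rewrite -[leLHS]mul1r ler_pdivrMr//; nra.
apply: (le_trans (ler_wpM2r (ltW (bern_mgf_gt0 _)) exp_le)).
rewrite /bern_mgf (_ : expR (2 * l) = expR l ^+ 2); last by rewrite -expRM_natl.
have z0 : 0 <= expR l - 1 by rewrite subr_ge0 -(expR0 R) ler_expR.
rewrite /x -subr_ge0.
set z := expR l - 1 in z0 *; have -> : expR l = 1 + z by rewrite /z; ring.
have -> : (1 + p * z) ^+ 2 -
    (1 - p * z ^+ 2) * (1 + p * ((1 + z) ^+ 2 - 1)) =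
    (p * z) ^+ 2 * (1 + 2 * z + z ^+ 2) by ring.
by rewrite mulr_ge0 ?sqr_ge0// !addr_ge0 ?mulr_ge0.
Qed.

Lemma heads_lower_tail (l : R) :
  1 / 2 <= \sum_(u : {ffun 'I_n -> bool * bool} |
      expR (l * #|heads u|%:R) <= 2 * bern_mgf l ^+ n) \prod_i coin (u i).
Proof.
have := @markov_half R _ _ (fun u => expR (l * #|heads u|%:R))
  prod_coin_ge0 sum_prod_coin (fun _ => expR_ge0 _).
by rewrite heads_mgf => /(_ (exprn_gt0 _ (bern_mgf_gt0 _))).
Qed.

End binomial_count.

(** * Distance to a cube in the tensor space *)

Section tensor_norm.
Variables (R : realType) (n d : nat).
Implicit Types u v : tensor_space R n d.

Lemma hdot_ge0 u : 0 <= hdot u u.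
Proof. by apply: sumr_ge0 => i _; exact: sqr_ge0. Qed.

Lemma hnorm_ge0 u : 0 <= hnorm u.
Proof. exact: sqrtr_ge0. Qed.

Lemma hnorm_sqr u : hnorm u ^+ 2 = hdot u u.
Proof. by rewrite sqr_sqrtr ?hdot_ge0. Qed.

Lemma ler_hnorm u v : (forall i, `|u i| <= `|v i|) -> hnorm u <= hnorm v.
Proof.
move=> uv; rewrite /hnorm ler_wsqrtr//; apply: ler_sum => i _.
rewrite -!expr2 -[leLHS]real_normK ?num_real// -[leRHS]real_normK ?num_real//.
by apply: lerXn2r; rewrite ?nnegrE.
Qed.

Lemma hnormZ (k : R) u : hnorm (k *: u : tensor_space R n d) = `|k| * hnorm u.
Proof.
rewrite /hnorm -sqrtr_sqr -sqrtrM ?sqr_ge0//; congr Num.sqrt.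
rewrite /hdot mulr_sumr; apply: eq_bigr => i _.
by rewrite ffunE /GRing.scale/=; ring.
Qed.

Lemma hnorm_eq0 u i : hnorm u = 0 -> u i = 0.
Proof.
move=> u0; apply/eqP; rewrite -sqrf_eq0 eq_le sqr_ge0 andbT.
apply: (@le_trans _ _ (hdot u u)); last by rewrite -hnorm_sqr u0 expr0n.
rewrite /hdot (bigD1 i)//= -expr2 lerDl.
by apply: sumr_ge0 => j _; exact: sqr_ge0.
Qed.

Lemma hdot_le u v : hdot u v <= hnorm u * hnorm v.
Proof.
have [u0|u0] := eqVneq (hnorm u) 0.
  by rewrite u0 mul0r /hdot big1// => i _; rewrite (hnorm_eq0 i u0) mul0r.
have [v0|v0] := eqVneq (hnorm v) 0.
  by rewrite v0 mulr0 /hdot big1// => i _; rewrite (hnorm_eq0 i v0) mulr0.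
have ab : 0 < hnorm u * hnorm v by rewrite mulr_gt0// lt_def hnorm_ge0 andbT.
rewrite -(ler_pM2l ab) -(@ler_pM2l _ 2)//.
have -> : 2 * (hnorm u * hnorm v * (hnorm u * hnorm v)) =
    hnorm v ^+ 2 * hnorm u ^+ 2 + hnorm u ^+ 2 * hnorm v ^+ 2 by ring.
rewrite {1}(hnorm_sqr u) {2}(hnorm_sqr v) /hdot !mulr_sumr -big_split/=.
apply: ler_sum => i _.
have := sqr_ge0 (hnorm v * u i - hnorm u * v i); nra.
Qed.

Lemma ler_hnormD u v : hnorm (u + v : tensor_space R n d) <= hnorm u + hnorm v.
Proof.
rewrite -ler_sqr ?nnegrE ?addr_ge0 ?hnorm_ge0//.
have -> : hnorm (u + v : tensor_space R n d) ^+ 2 =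
    hnorm u ^+ 2 + 2 * hdot u v + hnorm v ^+ 2.
  rewrite !hnorm_sqr /hdot mulr_sumr -!big_split/=.
  by apply: eq_bigr => i _; rewrite ffunE; ring.
have := hdot_le u v; nra.
Qed.

(** Up to the signs of its entries, the vector from the projection of u on the
cube [-tau, tau]^(n^d) to u, for tau >= 0; the norm of this vector is the
distance to the cube. *)
Definition excess (tau : R) u : tensor_space R n d :=
  [ffun i => Num.max (`|u i| - tau) 0].

Definition cube_dist (tau : R) u : R := hnorm (excess tau u).

Lemma cube_dist0 u : cube_dist 0 u = hnorm u.
Proof.
rewrite /cube_dist /hnorm; congr Num.sqrt; apply: eq_bigr => i _.
by rewrite ffunE subr0 (max_idPl _)// -!expr2 real_normK ?num_real.
Qed.

Lemma cube_dist_lipschitz (tau : R) : lipschitz1 (cube_dist tau).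
Proof.
suff H u v : cube_dist tau u <=
    cube_dist tau v + hnorm (u - v : tensor_space R n d).
  move=> u v; rewrite ler_norml; apply/andP; split; last first.
    by rewrite lerBlDl.
  rewrite lerNl opprB lerBlDl; apply: (le_trans (H v u)).
  by rewrite lerD2l; apply: ler_hnorm => i; rewrite !ffunE distrC.
rewrite /cube_dist -[X in hnorm X <= _](subrK (excess tau v)) addrC.
apply: (le_trans (ler_hnormD _ _)); rewrite lerD2l.
apply: ler_hnorm => i; rewrite !ffunE.
have := lerB_dist (u i) (v i); have := lerB_dist (v i) (u i).
rewrite [`|v i - u i|]distrC => h1 h2.
rewrite ler_norml; apply/andP; split;
  have [|] := leP (`|u i| - tau) 0; have [|] := leP (`|v i| - tau) 0; lra.
Qed.

(** The entries of excess are convex and nonnegative, and the norm is monotone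
on tensors with nonnegative entries. *)
Lemma cube_dist_convex (tau : R) :
  convex_function (E := tensor_space R n d) setT (cube_dist tau).
Proof.
move=> t u v _ _; have t0 : 0 <= t%:num by [].
have t1 : 0 <= 1 - t%:num by rewrite subr_ge0.
rewrite convRE.
have -> : t%:num * cube_dist tau u + (1 - t%:num) * cube_dist tau v =
   hnorm (t%:num *: excess tau u : tensor_space R n d) +
   hnorm ((1 - t%:num) *: excess tau v : tensor_space R n d).
  by rewrite !hnormZ !ger0_norm.
apply: le_trans (ler_hnormD _ _); apply: ler_hnorm => i.
rewrite !ffunE/= /GRing.scale/= /unstable.onem.
set a := t%:num in t0 t1 *.
have a1 : 0 <= Num.max (`|u i| - tau) 0 by rewrite le_max lexx orbT.
have b1 : 0 <= Num.max (`|v i| - tau) 0 by rewrite le_max lexx orbT.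
have a2 : `|u i| - tau <= Num.max (`|u i| - tau) 0 by rewrite le_max lexx.
have b2 : `|v i| - tau <= Num.max (`|v i| - tau) 0 by rewrite le_max lexx.
rewrite [leLHS]ger0_norm ?le_max ?lexx ?orbT//.
rewrite [leRHS]ger0_norm; last by rewrite addr_ge0// mulr_ge0.
rewrite ge_max; apply/andP; split; last by rewrite addr_ge0// mulr_ge0.
have := ler_normD (a * u i) ((1 - a) * v i).
rewrite !normrM (ger0_norm t0) (ger0_norm t1) => h.
have := ler_wpM2l t0 a2; have := ler_wpM2l t1 b2; lra.
Qed.

End tensor_norm.

(** * From a binomial variable to deviations *)

Definition deviates (R : realType) (n d : nat) (K0 delta pr : R) :=
  exists (disp : measure_display) (T : measurableType disp)
         (P : probability T R) (X : 'I_n -> {RV P >-> R})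
         (f : tensor_space R n d -> R),
    [/\ mutually_independent X,
        forall i, [/\ ('E_P[X i] = 0)%E,
                      ('E_P[fun w => (X i w ^+ 2)%R] = 1)%E
                    & (psi2_norm P (X i) <= K0%:E)%E],
        convex_function (E := tensor_space R n d) setT f,
        lipschitz1 f
      & forall m : R, (pr%:E <= P [set w | (delta <=
          `|f (tens_pow d (random_vector X w)) - m|)%R])%E].

(** A real m is at distance at least delta from one of lo and hi; on the side of
the midpoint where m lies, the event for the other value suffices. *)
Lemma two_level_deviation (R : realType) (n d : nat) (p a M K0 tau : R)
    (Lo Hi : pred nat) (lo hi delta pr : R) :
    0 <= p -> p <= 1 -> 0 <= a -> 0 <= M ->
    (1 - p) * a ^+ 2 + p * M ^+ 2 = 1 ->
    0 < K0 ->
    (1 - p) * expR (a ^+ 2 / K0 ^+ 2) + p * expR (M ^+ 2 / K0 ^+ 2) <= 2 ->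
    pr <= \sum_(u : {ffun 'I_n -> bool * bool} | Lo #|heads u|)
            \prod_i coin p (u i) ->
    pr <= \sum_(u : {ffun 'I_n -> bool * bool} | Hi #|heads u|)
            \prod_i coin p (u i) ->
    (forall (x : 'rV[R]_n) (S : {set 'I_n}),
      (forall i, `|x ord0 i| = if i \in S then M else a) ->
      (Lo #|S| -> cube_dist tau (tens_pow d x) <= lo) /\
      (Hi #|S| -> hi <= cube_dist tau (tens_pow d x))) ->
    2 * delta <= hi - lo ->
  deviates n d K0 delta pr.
Proof.
move=> p0 p1 a0 M0 var1 K0_gt0 psi2 prLo prHi flohi gap.
pose phi (v : bool * bool) : R :=
  (if v.2 then 1 else -1) * (if v.1 then M else a).
have [disp [T [P [X [w [mT indX XE EX PQ]]]]]] :=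
  iid_model (true, true) n phi (coin_ge0 p0 p1) (sum_coin1 p).
exists disp, T, P, X, (cube_dist tau); split=> //.
- move=> i; split.
  - rewrite (EX i id) sum_coin /phi/=; congr _%:E; by field.
  - rewrite (EX i (fun x => x ^+ 2)) sum_coin /phi/=; congr _%:E.
    by rewrite -[RHS]var1; field.
  - apply: ereal_inf_lbound; exists K0 => //=; split=> //.
    have -> := EX i (fun x => expR (x ^+ 2 / K0 ^+ 2)).
    rewrite sum_coin /phi/= lee_fin.
    by rewrite !mul1r !mulN1r !sqrrN; lra.
- exact: cube_dist_convex.
- exact: cube_dist_lipschitz.
move=> m.
have Xheads t i :
    `|random_vector X t ord0 i| = if i \in heads (w t) then M else a.
  rewrite mxE XE /phi normrM inE; case: (w t i) => b c /=.
  by case: c; rewrite ?normrN normr1 mul1r; case: b; rewrite ger0_norm.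
have [mle|mlt] := leP m ((lo + hi) / 2).
  apply: (@le_trans _ _ (P [set t | Hi #|heads (w t)|])).
    by rewrite (PQ (fun u => Hi #|heads u|)) lee_fin.
  apply: le_measure; rewrite ?inE//= => t /= Ht.
  have [_ /(_ Ht) fhi] := flohi _ _ (Xheads t).
  by apply: le_trans (ler_norm _); lra.
apply: (@le_trans _ _ (P [set t | Lo #|heads (w t)|])).
  by rewrite (PQ (fun u => Lo #|heads u|)) lee_fin.
apply: le_measure; rewrite ?inE//= => t /= Ht.
have [/(_ Ht) flo _] := flohi _ _ (Xheads t).
by rewrite distrC; apply: le_trans (ler_norm _); lra.
Qed.

(** * Tensor powers of vectors with two absolute values *)

Section two_level_tensor.
Variables (R : realType) (n d : nat) (a M : R).
Variables (x : 'rV[R]_n) (S : {set 'I_n}).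
Hypotheses (a_ge0 : 0 <= a) (aM : a <= M).
Hypothesis absx : forall i, `|x ord0 i| = if i \in S then M else a.

Let y i : R := if i \in S then M else a.

Let y_ge0 i : 0 <= y i.
Proof. by rewrite /y; case: ifP => // _; exact: le_trans aM. Qed.

Lemma sum_prod_pow (F : 'I_n -> R) :
  \sum_(i : {ffun 'I_d -> 'I_n}) \prod_k F (i k) = (\sum_j F j) ^+ d.
Proof.
by rewrite -(bigA_distr_bigA (fun (_ : 'I_d) j => F j)) prodr_const card_ord.
Qed.

Lemma sum_two_values (b c : R) :
  \sum_(j < n) (if j \in S then b else c) = c * (n%:R - #|S|%:R) + b * #|S|%:R.
Proof.
transitivity (\sum_(j < n) c + \sum_(j in S) (b - c)).
  rewrite [X in _ + X]big_mkcond -big_split/=; apply: eq_bigr => j _.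
  by case: ifP; rewrite ?addr0// addrC subrK.
by rewrite !sumr_const card_ord -[c *+ n]mulr_natr -mulr_natr; ring.
Qed.

Lemma norm_tens_pow i : `|tens_pow d x i| = \prod_k y (i k).
Proof.
rewrite ffunE normr_prod; apply: eq_bigr => k _; exact: absx.
Qed.

Lemma hnorm_two_level :
  hnorm (tens_pow d x) ^+ 2 =
  (a ^+ 2 * (n%:R - #|S|%:R) + M ^+ 2 * #|S|%:R) ^+ d.
Proof.
rewrite hnorm_sqr hdot_tens prodr_const card_ord -sum_two_values.
congr (_ ^+ d); apply: eq_bigr => j _.
by rewrite -expr2 -real_normK ?num_real// absx; case: ifP.
Qed.

(** An entry whose multi-index avoids S has absolute value a^d and lies in the
cube; an excess is at most the entry itself.  Hence the bound is the total
square norm minus the square norm carried by the multi-indices avoiding S. *)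
Lemma cube_dist_two_level_le :
  cube_dist (a ^+ d) (tens_pow d x) ^+ 2 <=
  (a ^+ 2 * (n%:R - #|S|%:R) + M ^+ 2 * #|S|%:R) ^+ d -
  (a ^+ 2 * (n%:R - #|S|%:R)) ^+ d.
Proof.
have -> : a ^+ 2 * (n%:R - #|S|%:R) =
    \sum_(j < n) (if j \in S then 0 else a ^+ 2).
  by rewrite sum_two_values mul0r addr0.
rewrite {1}(_ : \sum_j _ = a ^+ 2 * (n%:R - #|S|%:R)); last first.
  by rewrite sum_two_values mul0r addr0.
rewrite -sum_two_values -!sum_prod_pow -sumrB hnorm_sqr.
apply: ler_sum => i _; rewrite -expr2 ffunE norm_tens_pow.
have -> : \prod_k (if i k \in S then M ^+ 2 else a ^+ 2) =
    (\prod_k y (i k)) ^+ 2.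
  by rewrite -prodrXl; apply: eq_bigr => k _; rewrite /y; case: ifP.
have [/existsP[k kS]|/existsPn noS] := boolP [exists k, i k \in S].
  rewrite [X in _ <= _ - X](bigD1 k)//= kS mul0r subr0.
  rewrite ler_sqr ?nnegrE ?prodr_ge0// ?le_max ?lexx ?orbT//.
  by rewrite ge_max prodr_ge0// andbT gerDl oppr_le0 exprn_ge0.
have -> : \prod_k y (i k) = a ^+ d.
  rewrite -[d in RHS]card_ord -prodr_const.
  by apply: eq_bigr => k _; rewrite /y (negbTE (noS k)).
rewrite subrr maxxx expr0n/= subr_ge0.
rewrite (eq_bigr (fun=> a ^+ 2)) => [|k _]; last by rewrite (negbTE (noS k)).
by rewrite prodr_const card_ord -!exprM mulnC.
Qed.

(** An entry whose multi-index meets S is at least M a^(d-1), so its excess over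
a^d is at least (M - a) a^(d-1); the last factor counts these indices. *)
Lemma cube_dist_two_level_ge : (0 < d)%N ->
  (M - a) ^+ 2 * (a ^+ 2) ^+ d.-1 * (n%:R ^+ d - (n%:R - #|S|%:R) ^+ d) <=
  cube_dist (a ^+ d) (tens_pow d x) ^+ 2.
Proof.
move=> d_gt0.
have -> : n%:R - #|S|%:R = \sum_(j < n) (if j \in S then 0 else 1) :> R.
  by rewrite sum_two_values mul0r addr0 mul1r.
have -> : n%:R = \sum_(j < n) 1 :> R by rewrite sumr_const card_ord.
rewrite -!sum_prod_pow -sumrB hnorm_sqr mulr_sumr.
apply: ler_sum => i _; rewrite -expr2 ffunE norm_tens_pow big1//.
have [/existsP[k kS]|/existsPn noS] := boolP [exists k, i k \in S]; last first.
  rewrite big1 => [|k _]; last by rewrite (negbTE (noS k)).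
  by rewrite subrr mulr0 sqr_ge0.
rewrite (bigD1 k)//= kS mul0r subr0 mulr1 -exprM mulnC exprM -exprMn.
have le_prod : a ^+ d.-1 <= \prod_(j | j != k) y (i j).
  rewrite -[d in leLHS](card_ord d) -(cardC1 k) -prodr_const.
  apply: ler_prod => j _; rewrite a_ge0/= /y; by case: ifP.
rewrite ler_sqr ?nnegrE ?le_max ?lexx ?orbT//; last first.
  by rewrite mulr_ge0 ?subr_ge0 ?exprn_ge0.
rewrite (bigD1 k)//= {1}/y kS; apply/orP; left.
rewrite mulrBl -exprS prednK// lerD2r.
by apply: ler_wpM2l => //; exact: le_trans aM.
Qed.

End two_level_tensor.

(** * Elementary inequalities *)

Section elementary.
Variable R : realType.
Implicit Types x y z l : R.

Lemma expR_le1D2 x : 0 <= x -> x <= 1 / 2 -> expR x <= 1 + 2 * x.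
Proof.
move=> x0 x1; have h : 0 < 1 - x by lra.
rewrite -[expR x]invrK -expRN; apply: (@le_trans _ _ (1 - x)^-1).
  by rewrite lef_pV2 ?posrE ?expR_gt0//; exact: expR_ge1Dx.
by rewrite -[leLHS]mul1r ler_pdivrMr//; nra.
Qed.

Lemma expR_le1DD2 x : 0 <= x -> x <= 1 / 2 -> expR x <= 1 + x + 2 * x ^+ 2.
Proof.
move=> x0 x1; have h : 0 < 1 - x by lra.
rewrite -[expR x]invrK -expRN; apply: (@le_trans _ _ (1 - x)^-1).
  by rewrite lef_pV2 ?posrE ?expR_gt0//; exact: expR_ge1Dx.
rewrite -[leLHS]mul1r ler_pdivrMr// -subr_ge0.
have -> : (1 + x + 2 * x ^+ 2) * (1 - x) - 1 = x ^+ 2 * (1 - 2 * x) by ring.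
by rewrite mulr_ge0 ?sqr_ge0//; lra.
Qed.

Lemma expR1_ge2 : 2 <= expR 1 :> R.
Proof. by have := @expR_ge1Dx R 1; lra. Qed.

Lemma expR1_le4 : expR 1 <= 4 :> R.
Proof.
have -> : 1 = 2 * (1 / 2) :> R by field.
have h : expR (1 / 2) <= 2 :> R by apply: le_trans (expR_le1D2 _ _) _; lra.
rewrite expRM_natl; have := @expR_ge0 R (1 / 2); nra.
Qed.

Lemma expR16_ge : 11 ^+ 4 <= expR 16 :> R.
Proof.
have h : 11 <= expR 4 :> R.
  have := @expR_ge1Dxn R 4 2 (ler0n _ 4); apply: le_trans.
  by rewrite (_ : (3`!)%:R = 6)//; lra.
have -> : 16 = 4 * 4 :> R by ring.
by rewrite expRM_natl; apply: lerXn2r; rewrite ?nnegrE ?expR_ge0.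
Qed.

(** This is the second order term of the moment generating function of a fair
coin: (1 + exp l) / 2 = exp (l / 2) cosh (l / 2).  With E = exp (l / 4), the
claim on cosh follows from E^2 - 1 >= E l / 4. *)
Lemma fair_mgf_ge l : 0 <= l -> l <= 1 ->
  expR (l / 2 + l ^+ 2 / 64) <= bern_mgf (1 / 2) l.
Proof.
move=> l0 l1; rewrite expRD /bern_mgf.
pose E := expR (l / 4).
have E1 : 1 + l / 4 <= E by exact: expR_ge1Dx.
have -> : expR (l / 2) = E ^+ 2 by rewrite -expRM_natl; congr expR; field.
have -> : expR l = E ^+ 4 by rewrite -expRM_natl; congr expR; field.
have h : expR (l ^+ 2 / 64) <= 1 + 2 * (l ^+ 2 / 64).
  by apply: expR_le1D2; nra.
apply: (le_trans (ler_wpM2l (sqr_ge0 E) h)).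
rewrite -subr_ge0.
have -> : 1 + 1 / 2 * (E ^+ 4 - 1) - E ^+ 2 * (1 + 2 * (l ^+ 2 / 64)) =
    ((E ^+ 2 - 1) ^+ 2 - (E * (l / 4)) ^+ 2) / 2 by field.
have h1 : 0 <= E * (l / 4) by apply: mulr_ge0; lra.
have h2 : E * (l / 4) <= E ^+ 2 - 1 by nra.
rewrite divr_ge0// subr_ge0; apply: lerXn2r; rewrite ?nnegrE//; lra.
Qed.

Lemma subrX_ge d y z : 0 <= y -> y <= z ->
  d%:R * (z - y) * y ^+ d.-1 <= z ^+ d - y ^+ d.
Proof.
move=> y0 yz; elim: d => [|d IH]; first by rewrite mul0r mul0r subrr.
have yd := exprn_ge0 d y0.
rewrite !exprS /=.
have -> : z * z ^+ d - y * y ^+ d = z * (z ^+ d - y ^+ d) + (z - y) * y ^+ d.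
  by ring.
have -> : d.+1%:R * (z - y) * y ^+ d =
    d%:R * (z - y) * y ^+ d + (z - y) * y ^+ d by rewrite -natr1; ring.
rewrite lerD2r; case: d IH yd => [|d] IH yd.
  by rewrite !mul0r subrr mulr0.
have IH0 : 0 <= d.+1%:R * (z - y) * y ^+ d.
  by rewrite !mulr_ge0 ?exprn_ge0 ?subr_ge0.
rewrite [y ^+ d.+1 in leLHS]exprS mulrCA.
apply: ler_pM => //; lra.
Qed.

Lemma subrX_le d y z : 0 <= y -> y <= z ->
  z ^+ d - y ^+ d <= d%:R * (z - y) * z ^+ d.-1.
Proof.
move=> y0 yz; have z0 := le_trans y0 yz.
elim: d => [|d IH]; first by rewrite mul0r mul0r subrr.
have yd : y ^+ d <= z ^+ d by apply: lerXn2r; rewrite ?nnegrE.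
rewrite !exprS /=.
have -> : z * z ^+ d - y * y ^+ d = z * (z ^+ d - y ^+ d) + (z - y) * y ^+ d.
  by ring.
have -> : d.+1%:R * (z - y) * z ^+ d =
    d%:R * (z - y) * z ^+ d + (z - y) * z ^+ d by rewrite -natr1; ring.
apply: lerD; last by apply: ler_wpM2l => //; rewrite subr_ge0.
case: d IH yd => [|d] IH yd; first by rewrite !mul0r subrr mulr0.
by rewrite [z ^+ d.+1 in leRHS]exprS mulrCA; exact: ler_wpM2l.
Qed.

Lemma powR_half_pred n d : (0 < d)%N ->
  n%:R `^ ((d%:R - 1) / 2) = Num.sqrt n%:R ^+ d.-1 :> R.
Proof.
case: d => // d _; rewrite -natr1 addrK mulrC powRrM powR12_sqrt//.
by rewrite powR_mulrn ?sqrtr_ge0.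
Qed.

End elementary.

(** * The regime of rate s^2 / d^2 *)

Lemma ler_sum_sub (R : realType) (T : finType) (w : T -> R) (Q Q' : pred T) :
    (forall t, 0 <= w t) -> (forall t, Q t -> Q' t) ->
  \sum_(t | Q t) w t <= \sum_(t | Q' t) w t.
Proof.
move=> w0 QQ'; rewrite big_mkcond [leRHS]big_mkcond/=; apply: ler_sum => t _.
by case: ifP => [/QQ' ->//|_]; case: ifP.
Qed.

(** The factors 1/2 and 1/4 of the tail bound are absorbed in the exponentials,
so that the hypothesis on Hi compares exponents only. *)
Lemma heads_prob_upper (R : realType) (n : nat) (p l : R) (Hi : pred nat) :
    0 <= p -> p <= 1 -> 0 <= l -> p * (expR l - 1) ^+ 2 <= 1 / 2 ->
    (forall k : nat, bern_mgf p l ^+ n <= expR (l * k%:R + 1) -> Hi k) ->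
  expR (- (2 * (n%:R * (p * (expR l - 1) ^+ 2)) + 2)) <=
  \sum_(u : {ffun 'I_n -> bool * bool} | Hi #|heads u|) \prod_i coin p (u i).
Proof.
move=> p0 p1 l0 small HiP.
apply: le_trans (le_trans (heads_upper_tail n p0 p1 l0 small) _).
  rewrite opprD expRD ler_wpM2l ?expR_ge0// expRN lef_pV2 ?posrE ?expR_gt0//.
  have -> : 2 = 2 * 1 :> R by ring.
  by rewrite expRM_natl; have := expR1_ge2 R; nra.
apply: ler_sum_sub => [u|u h]; first exact: prod_coin_ge0.
apply: HiP; rewrite expRD.
have := expR1_ge2 R; have := expR_gt0 (l * #|heads u|%:R); nra.
Qed.

Lemma heads_prob_lower (R : realType) (n : nat) (p l : R) (Lo : pred nat) :
    0 <= p -> p <= 1 ->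
    (forall k : nat, expR (l * k%:R) <= expR 1 * bern_mgf p l ^+ n -> Lo k) ->
  1 / 2 <=
  \sum_(u : {ffun 'I_n -> bool * bool} | Lo #|heads u|) \prod_i coin p (u i).
Proof.
move=> p0 p1 LoP; apply: le_trans (heads_lower_tail n p0 p1 l) _.
apply: ler_sum_sub => [u|u h]; first exact: prod_coin_ge0.
apply: LoP; apply: (le_trans h); apply: ler_wpM2r; last exact: expR1_ge2.
by rewrite exprn_ge0// ltW// bern_mgf_gt0.
Qed.

Lemma bern_mgf_le (R : realType) (p l : R) (n : nat) : 0 <= p -> p <= 1 ->
  bern_mgf p l ^+ n <= expR (n%:R * (p * (expR l - 1))).
Proof.
move=> p0 p1; rewrite expRM_natl; apply: lerXn2r; last exact: expR_ge1Dx.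
  by rewrite nnegrE ltW// bern_mgf_gt0.
by rewrite nnegrE expR_ge0.
Qed.

(** For l = 256 t / sqrt n, the lower bound on the moment generating function
yields N >= n / 2 + n l / 64 - 1 / l with n l / 64 = 4 t sqrt n, at a cost of
order n l^2, which is of order t^2. *)
Lemma fair_coin_upper (R : realType) (n : nat) (t : R) :
    1 <= t -> 512 * t <= Num.sqrt n%:R ->
  expR (- ((4 * 256 ^+ 2 + 2) * t ^+ 2)) <=
  \sum_(u : {ffun 'I_n -> bool * bool} |
      n%:R / 2 + 3 * t * Num.sqrt n%:R <= #|heads u|%:R :> R)
    \prod_i coin (1 / 2) (u i).
Proof.
set sg := Num.sqrt n%:R => t1 t_le.
have nE : n%:R = sg ^+ 2 :> R by rewrite sqr_sqrtr.
have sg0 : 0 < sg by lra.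
pose l := 256 * t / sg.
have lsg : l * sg = 256 * t by rewrite /l divfK ?gt_eqF.
have l0 : 0 < l by rewrite -(pmulr_lgt0 _ sg0) lsg; lra.
have l_le : l <= 1 / 2 by rewrite -(ler_pM2r sg0) lsg; lra.
have el2 : (expR l - 1) ^+ 2 <= 4 * l ^+ 2.
  by have := expR_le1D2 (ltW l0) l_le; have := expR_ge1Dx l; nra.
have small : 1 / 2 * (expR l - 1) ^+ 2 <= 1 / 2 by nra.
have half0 : 0 <= 1 / 2 :> R by [].
have half1 : 1 / 2 <= 1 :> R by lra.
pose Hi (k : nat) := n%:R / 2 + 3 * t * sg <= k%:R.
apply: le_trans (heads_prob_upper half0 half1 (ltW l0) small
  (_ : forall k : nat, _ -> Hi k)).
  rewrite ler_expR lerN2.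
  apply: (@le_trans _ _ (2 * (n%:R * (1 / 2 * (4 * l ^+ 2))) + 2)).
    by rewrite lerD2r !ler_wpM2l.
  have -> : 2 * (n%:R * (1 / 2 * (4 * l ^+ 2))) = 4 * (l * sg) ^+ 2.
    by rewrite nE; field.
  have t2 : 1 <= t ^+ 2 by rewrite exprn_ege1.
  have -> : (4 * 256 ^+ 2 + 2) * t ^+ 2 = 4 * (256 * t) ^+ 2 + 2 * t ^+ 2.
    by ring.
  by rewrite lsg lerD2l -[leLHS]mulr1 ler_wpM2l.
move=> k h; rewrite /Hi.
have {}h : n%:R * (l / 2 + l ^+ 2 / 64) <= l * k%:R + 1.
  rewrite -ler_expR; apply: le_trans h; rewrite expRM_natl; apply: lerXn2r.
  - by rewrite nnegrE expR_ge0.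
  - by rewrite nnegrE ltW// bern_mgf_gt0.
  - by apply: fair_mgf_ge; [exact: ltW|exact: le_trans l_le _].
rewrite -(ler_pM2l l0) -(lerD2r 1); apply: le_trans h.
have -> : l * (n%:R / 2 + 3 * t * sg) + 1 =
    l * n%:R / 2 + (3 * t * (l * sg) + 1).
  by field.
have -> : n%:R * (l / 2 + l ^+ 2 / 64) = l * n%:R / 2 + (l * sg) ^+ 2 / 64.
  by rewrite nE; field.
by rewrite lerD2l lsg; nra.
Qed.

(** The exponent 1 / sqrt n is the scale at which exp (l N) varies by a bounded
factor over one standard deviation. *)
Lemma fair_coin_lower (R : realType) (n : nat) : 2 <= Num.sqrt n%:R :> R ->
  1 / 2 <=
  \sum_(u : {ffun 'I_n -> bool * bool} |
      #|heads u|%:R <= n%:R / 2 + 2 * Num.sqrt n%:R :> R)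
    \prod_i coin (1 / 2) (u i) :> R.
Proof.
set sg := Num.sqrt n%:R => sg2.
have nE : n%:R = sg ^+ 2 :> R by rewrite sqr_sqrtr.
have sg0 : 0 < sg by lra.
pose mu := sg^-1.
have musg : mu * sg = 1 by rewrite /mu mulVf ?gt_eqF.
have mu0 : 0 < mu by rewrite invr_gt0.
have mu_le : mu <= 1 / 2 by rewrite -(ler_pM2r sg0) musg; lra.
have half0 : 0 <= 1 / 2 :> R by [].
have half1 : 1 / 2 <= 1 :> R by lra.
pose Lo (k : nat) := k%:R <= n%:R / 2 + 2 * sg.
apply: (heads_prob_lower half0 half1 (l := mu) (_ : forall k : nat, _ -> Lo k)).
move=> k h; rewrite /Lo.
have {}h : mu * k%:R <= 1 + n%:R * (1 / 2 * (expR mu - 1)).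
  rewrite -ler_expR; apply: (le_trans h).
  by rewrite expRD ler_wpM2l ?expR_ge0//; exact: bern_mgf_le.
have hmu := expR_le1DD2 (ltW mu0) mu_le.
have h2 : n%:R * (1 / 2 * (expR mu - 1)) <= n%:R * (1 / 2 * (mu + 2 * mu ^+ 2)).
  by rewrite !ler_wpM2l//; lra.
have {h h2}h := le_trans h (lerD (lexx 1) h2).
rewrite -(ler_pM2l mu0); apply: (le_trans h).
have -> : mu * (n%:R / 2 + 2 * sg) = (mu * sg) * sg / 2 + 2 * (mu * sg).
  by rewrite nE; ring.
have -> : n%:R * (1 / 2 * (mu + 2 * mu ^+ 2)) =
   (mu * sg) * sg / 2 + (mu * sg) ^+ 2 by rewrite nE; field.
rewrite musg; lra.
Qed.

(** Large and small squares are 3/2 and 1/2, so that |X|^2 = n / 2 + N.  The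
bounds N <= n / 2 + 2 sqrt n and N >= n / 2 + 3 t sqrt n put |X| below
sqrt n + 1 and above sqrt n + 5 t / 4 respectively. *)
Lemma norm_deviates (R : realType) (c C : R) (n d : nat) (s : R) :
    0 < c -> c <= 1 / 512 -> 4 * 256 ^+ 2 + 2 <= C ->
    (0 < d)%N -> 0 < s -> s <= c * Num.sqrt n%:R ->
    1 <= s ^+ 2 / d%:R ^+ 2 ->
  deviates n d 2 (c * n%:R `^ ((d%:R - 1) / 2) * s)
    (expR (- (C * (s ^+ 2 / d%:R ^+ 2)))).
Proof.
move=> c0 c_le C_ge d0 s0 s_le; rewrite powR_half_pred//.
have := @fair_coin_lower R n; have := @fair_coin_upper R n.
move: s_le; set sg := Num.sqrt n%:R => s_le upper lower.
have nE : n%:R = sg ^+ 2 :> R by rewrite sqr_sqrtr.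
have dR : 0 < d%:R :> R by rewrite ltr0n.
have d1 : 1 <= d%:R :> R by rewrite ler1n.
rewrite -expr_div_n; set t := s / d%:R.
have sE : s = t * d%:R by rewrite /t divfK ?gt_eqF.
have t0 : 0 < t by rewrite divr_gt0.
move=> t2; have t1 : 1 <= t by rewrite -(@ler_pXn2r _ 2) ?nnegrE ?expr1n// ltW.
have t_le : 512 * t <= sg.
  have ts : t <= s by rewrite sE -[leLHS]mulr1 ler_wpM2l// ltW.
  have sg_ge : 0 <= sg by exact: sqrtr_ge0.
  have := ler_wpM2r sg_ge c_le; lra.
have sg0 : 0 < sg by lra.
pose a : R := Num.sqrt (1 / 2); pose M : R := Num.sqrt (3 / 2).
have a2 : a ^+ 2 = 1 / 2 by rewrite sqr_sqrtr.
have M2 : M ^+ 2 = 3 / 2 by rewrite sqr_sqrtr// divr_ge0.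
apply: (@two_level_deviation _ _ _ (1 / 2) a M 2 0
  (fun k => k%:R <= n%:R / 2 + 2 * sg)
  (fun k => n%:R / 2 + 3 * t * sg <= k%:R)
  ((sg + 1) ^+ d) ((sg + 5 / 4 * t) ^+ d)) => //.
- by lra.
- exact: sqrtr_ge0.
- exact: sqrtr_ge0.
- by rewrite a2 M2; field.
- rewrite a2 M2 {s_le upper lower t_le}.
  have h1 : expR (1 / 2 / 2 ^+ 2) <= 1 + 2 * (1 / 2 / 2 ^+ 2) :> R.
    by apply: expR_le1D2; lra.
  have h2 : expR (3 / 2 / 2 ^+ 2) <= 1 + 2 * (3 / 2 / 2 ^+ 2) :> R.
    by apply: expR_le1D2; lra.
  lra.
- apply: (@le_trans _ _ (1 / 2)); last by apply: lower; lra.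
  have -> : 1 / 2 = (expR (ln 2))^-1 :> R by rewrite lnK ?posrE// mul1r.
  rewrite -expRN ler_expR lerN2.
  have ln2 : ln 2 <= 1 :> R.
    by rewrite -[leRHS]expRK ler_ln ?posrE ?expR_gt0// expR1_ge2.
  have C1 : 1 <= C by apply: le_trans C_ge; lra.
  by apply: le_trans ln2 _; rewrite -[leLHS]mulr1 ler_pM.
- apply: le_trans (upper t t1 t_le).
  by rewrite ler_expR lerN2 ler_wpM2r ?sqr_ge0.
- move=> x S absx; rewrite cube_dist0.
  have := hnorm_two_level d absx; rewrite a2 M2.
  have -> : 1 / 2 * (n%:R - #|S|%:R) + 3 / 2 * #|S|%:R =
      n%:R / 2 + #|S|%:R :> R.
    by field.
  move=> fE; rewrite nE; split=> hS.
  + have s10 : 0 <= sg + 1 by lra.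
    rewrite -(@ler_pXn2r _ 2) ?nnegrE ?hnorm_ge0 ?exprn_ge0//.
    rewrite fE -exprM mulnC exprM nE.
    apply: lerXn2r; rewrite ?nnegrE ?sqr_ge0 ?addr_ge0 ?divr_ge0 ?sqr_ge0//.
    rewrite sqrrD; lra.
  + have st0 : 0 <= sg + 5 / 4 * t by lra.
    rewrite -(@ler_pXn2r _ 2) ?nnegrE ?hnorm_ge0 ?exprn_ge0//.
    rewrite fE -exprM mulnC exprM nE.
    apply: lerXn2r; rewrite ?nnegrE ?sqr_ge0 ?addr_ge0 ?divr_ge0 ?sqr_ge0//.
    have : t ^+ 2 <= t * sg / 512.
      by rewrite expr2 -mulrA ler_wpM2l ?(ltW t0)//; lra.
    rewrite sqrrD; lra.
- have h : sg + 1 <= sg + 5 / 4 * t by lra.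
  apply: le_trans (subrX_ge d (addr_ge0 (ltW sg0) ler01) h).
  have h2 : sg ^+ d.-1 <= (sg + 1) ^+ d.-1.
    by apply: lerXn2r; rewrite ?nnegrE; lra.
  have h3 : 0 <= d%:R * (sg + 5 / 4 * t - (sg + 1)).
    by rewrite mulr_ge0 ?subr_ge0.
  apply: le_trans (ler_wpM2l h3 h2).
  have -> : 2 * (c * sg ^+ d.-1 * s) = d%:R * (2 * c * t) * sg ^+ d.-1.
    by rewrite sE; ring.
  rewrite ler_wpM2r ?exprn_ge0 ?(ltW sg0)// ler_wpM2l ?ler0n//.
  have := ler_wpM2r (ltW t0) c_le; lra.
Qed.

(** * The regime of rate s^2 / (d L) *)

(** For a fixed exponent l the cost is of order n p, while N reaches at least
(n p (exp l - 1) / 2 - 1) / l; the choice l = 16 makes this exceed 400 n p. *)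
Lemma rare_coin_upper (R : realType) (n : nat) (p : R) :
    0 <= p -> p <= 1 -> 1 <= n%:R * p -> p * expR 32 <= 1 / 2 ->
  expR (- ((2 * expR 32 + 2) * (n%:R * p))) <=
  \sum_(u : {ffun 'I_n -> bool * bool} | 400 * (n%:R * p) <= #|heads u|%:R :> R)
    \prod_i coin p (u i).
Proof.
move=> p0 p1 np1 pE; pose E : R := expR 16.
have E_ge : 11 ^+ 4 <= E := expR16_ge R.
have E2 : expR 32 = E ^+ 2 by rewrite -expRM_natl; congr expR; ring.
rewrite E2 in pE *.
have z2 : (E - 1) ^+ 2 <= E ^+ 2 by apply: lerXn2r; rewrite ?nnegrE; lra.
have small : p * (E - 1) ^+ 2 <= 1 / 2.
  by apply: le_trans pE; rewrite ler_wpM2l.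
have xle : p * (E - 1) <= 1 / 2.
  by apply: le_trans small; rewrite ler_wpM2l// expr2 ler_peMr//; lra.
have l0 : 0 <= 16 :> R by [].
pose Hi (k : nat) := 400 * (n%:R * p) <= k%:R.
apply: le_trans (heads_prob_upper p0 p1 l0 small
  (_ : forall k : nat, _ -> Hi k)).
  rewrite -/E ler_expR lerN2.
  have : n%:R * (p * (E - 1) ^+ 2) <= E ^+ 2 * (n%:R * p).
    by rewrite mulrA mulrC ler_wpM2r// (le_trans ler01).
  rewrite mulrDl; lra.
move=> k h; rewrite /Hi.
have {}h : n%:R * (p * (E - 1) / 2) <= 16 * k%:R + 1.
  rewrite -ler_expR; apply: le_trans h; rewrite expRM_natl; apply: lerXn2r.
  - by rewrite nnegrE expR_ge0.
  - by rewrite nnegrE ltW// bern_mgf_gt0.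
  - have x0 : 0 <= p * (E - 1) by apply: mulr_ge0 => //; lra.
    apply: le_trans (expR_le1D2 _ _) _; rewrite ?divr_ge0//; first lra.
    by rewrite /bern_mgf -/E mulrC divfK.
have : 70 * 100 * (n%:R * p) <= n%:R * (p * (E - 1) / 2).
  have -> : n%:R * (p * (E - 1) / 2) = (E - 1) / 2 * (n%:R * p) by ring.
  by rewrite ler_wpM2r ?(le_trans ler01)//; lra.
lra.
Qed.

Lemma rare_coin_lower (R : realType) (n : nat) (p : R) :
    0 <= p -> p <= 1 -> 1 <= n%:R * p ->
  1 / 2 <= \sum_(u : {ffun 'I_n -> bool * bool} |
      #|heads u|%:R <= 4 * (n%:R * p) :> R) \prod_i coin p (u i).
Proof.
move=> p0 p1 np1; pose Lo (k : nat) := k%:R <= 4 * (n%:R * p).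
apply: (heads_prob_lower p0 p1 (l := 1) (_ : forall k : nat, _ -> Lo k)).
move=> k h; rewrite /Lo.
have {}h : 1 * k%:R <= 1 + n%:R * (p * (expR 1 - 1)).
  rewrite -ler_expR; apply: (le_trans h).
  by rewrite expRD ler_wpM2l ?expR_ge0//; exact: bern_mgf_le.
have : n%:R * (p * (expR 1 - 1)) <= 3 * (n%:R * p).
  rewrite mulrA [leRHS]mulrC ler_wpM2l ?(le_trans ler01)//.
  have := expR1_le4 R; lra.
lra.
Qed.

Lemma half_le_1BX (R : realType) (m : nat) (z : R) :
  0 <= z -> z <= 1 -> m%:R * z <= 1 / 2 -> 1 / 2 <= (1 - z) ^+ m.
Proof.
move=> z0 z1 mz; have h : 1 - z <= 1 by lra.
have h0 : 0 <= 1 - z by lra.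
have := subrX_le m h0 h; rewrite !expr1n mulr1 subKr; lra.
Qed.

Section rare_values.
Variables (R : realType) (n d : nat) (a M s : R).
Variables (x : 'rV[R]_n) (S : {set 'I_n}).
Hypotheses (a_ge0 : 0 <= a) (a2_le1 : a ^+ 2 <= 1) (aM : 2 * a <= M).
Hypotheses (d_gt0 : (0 < d)%N) (s_gt0 : 0 < s) (sn : 8 * s ^+ 2 <= n%:R).
Hypothesis absx : forall i, `|x ord0 i| = if i \in S then M else a.

Let aM1 : a <= M. Proof. by move: a_ge0 aM; lra. Qed.
Let n_gt0 : 0 < n%:R :> R.
Proof. by apply: lt_le_trans sn; rewrite mulr_gt0// exprn_gt0. Qed.
Let S_le : #|S|%:R <= n%:R :> R.
Proof. by rewrite ler_nat -[leqRHS](card_ord n) max_card. Qed.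
Let dR : 0 < d%:R :> R. Proof. by rewrite ltr0n. Qed.
Let sqr_sqrtn : (Num.sqrt n%:R ^+ d.-1) ^+ 2 = n%:R ^+ d.-1 :> R.
Proof. by rewrite -exprM mulnC exprM sqr_sqrtr. Qed.

(** With w = M^2 #|S| the square distance is at most
(a^2 (n - #|S|) + w)^d - (a^2 (n - #|S|))^d <= d w (n + w)^(d-1), and
(n + w)^(d-1) <= 2 n^(d-1) because d w / n <= 1/2. *)
Lemma cube_dist_few : d%:R * (M ^+ 2 * #|S|%:R) <= 4 * s ^+ 2 ->
  cube_dist (a ^+ d) (tens_pow d x) <= 3 * s * Num.sqrt n%:R ^+ d.-1.
Proof.
move=> few.
have rhs0 : 0 <= 3 * s * Num.sqrt n%:R ^+ d.-1.
  by rewrite !mulr_ge0 ?exprn_ge0 ?sqrtr_ge0// ltW.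
rewrite -(@ler_pXn2r _ 2) ?nnegrE ?hnorm_ge0//.
apply: le_trans (cube_dist_two_level_le d a_ge0 aM1 absx) _.
rewrite [in leRHS]exprMn sqr_sqrtn.
set u := a ^+ 2 * _; set w := M ^+ 2 * _ in few *.
have u0 : 0 <= u by rewrite mulr_ge0 ?sqr_ge0 ?subr_ge0.
have w0 : 0 <= w by rewrite mulr_ge0 ?sqr_ge0.
have un : u <= n%:R.
  apply: (@le_trans _ _ (1 * n%:R)); last by rewrite mul1r.
  by apply: ler_pM; rewrite ?sqr_ge0 ?subr_ge0// gerBl.
apply: le_trans (subrX_le d u0 (_ : u <= u + w)) _; first by rewrite lerDl.
rewrite [u + w - u]addrAC subrr add0r.
pose v := 4 * s ^+ 2 / n%:R.
have vn : v * n%:R = 4 * s ^+ 2 by rewrite /v divfK ?gt_eqF.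
have v0 : 0 <= v by rewrite divr_ge0 ?(ltW n_gt0)// mulr_ge0 ?sqr_ge0.
have v_le : v <= 1 / 2 by rewrite -(ler_pM2r n_gt0) vn; move: sn; lra.
have h1 : u + w <= expR (v / d%:R) * n%:R.
  apply: (@le_trans _ _ ((1 + v / d%:R) * n%:R)); last first.
    by rewrite ler_wpM2r ?expR_ge1Dx.
  rewrite mulrDl mul1r lerD// mulrAC vn ler_pdivlMr// mulrC; exact: few.
have h2 : (u + w) ^+ d.-1 <= 2 * n%:R ^+ d.-1.
  apply: (@le_trans _ _ ((expR (v / d%:R) * n%:R) ^+ d.-1)).
    apply: lerXn2r => //; rewrite nnegrE; first exact: addr_ge0.
    by rewrite mulr_ge0 ?expR_ge0.
  rewrite exprMn ler_wpM2r ?exprn_ge0// -expRM_natl.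
  apply: (@le_trans _ _ (expR v)).
    rewrite ler_expR mulrCA ler_piMr// ler_pdivrMr// mul1r ler_nat.
    exact: leq_pred.
  by apply: le_trans (expR_le1D2 _ _) _; lra.
apply: le_trans (ler_wpM2l (mulr_ge0 (ltW dR) w0) h2) _.
rewrite mulrA ler_wpM2r ?exprn_ge0// exprMn.
have := sqr_ge0 s; lra.
Qed.

(** Only r of the large coordinates are counted, with d r <= n / 2, so that the
multi-indices meeting r given coordinates number at least d r n^(d-1) / 2. *)
Lemma cube_dist_many (r : R) : 0 <= r -> r <= #|S|%:R ->
    d%:R * (1 - a ^+ 2) <= 1 / 2 -> d%:R * r <= n%:R / 2 ->
    d%:R * (M ^+ 2 * r) = 400 * s ^+ 2 ->
  5 * s * Num.sqrt n%:R ^+ d.-1 <= cube_dist (a ^+ d) (tens_pow d x).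
Proof.
move=> r0 rS da dr many.
have lhs0 : 0 <= 5 * s * Num.sqrt n%:R ^+ d.-1.
  by rewrite !mulr_ge0 ?exprn_ge0 ?sqrtr_ge0// ltW.
rewrite -(@ler_pXn2r _ 2) ?nnegrE ?hnorm_ge0//.
apply: le_trans _ (cube_dist_two_level_ge a_ge0 aM1 absx d_gt0).
rewrite [in leLHS]exprMn sqr_sqrtn.
have pred_le : d.-1%:R <= d%:R :> R by rewrite ler_nat leq_pred.
have rn : r <= n%:R by exact: le_trans S_le.
have h1 : M ^+ 2 / 4 <= (M - a) ^+ 2.
  have -> : M ^+ 2 / 4 = (M / 2) ^+ 2 by field.
  by apply: lerXn2r; rewrite ?nnegrE; move: aM a_ge0; lra.
have h2 : 1 / 2 <= (a ^+ 2) ^+ d.-1.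
  have -> : a ^+ 2 = 1 - (1 - a ^+ 2) by ring.
  apply: half_le_1BX; rewrite ?subr_ge0 ?gerBl ?sqr_ge0//.
  by apply: le_trans da; rewrite ler_wpM2r ?subr_ge0.
have h3 : 1 / 2 * n%:R ^+ d.-1 <= (n%:R - r) ^+ d.-1.
  have -> : n%:R - r = (1 - r / n%:R) * n%:R.
    by rewrite mulrBl mul1r divfK ?gt_eqF.
  rewrite exprMn ler_wpM2r ?exprn_ge0//.
  apply: half_le_1BX; rewrite ?divr_ge0//; first by rewrite ler_pdivrMr// mul1r.
  rewrite mulrA ler_pdivrMr// [leRHS]mulrAC mul1r; apply: le_trans dr.
  by rewrite ler_wpM2r.
have h4 : d%:R * r * (1 / 2 * n%:R ^+ d.-1) <=
    n%:R ^+ d - (n%:R - #|S|%:R) ^+ d.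
  apply: (@le_trans _ _ (n%:R ^+ d - (n%:R - r) ^+ d)); last first.
    rewrite lerD2l lerN2; apply: lerXn2r; rewrite ?nnegrE ?subr_ge0//.
    by rewrite lerD2l lerN2.
  apply: le_trans (subrX_ge d (_ : 0 <= n%:R - r) (_ : n%:R - r <= n%:R)).
  - by rewrite subKr ler_wpM2l ?mulr_ge0.
  - by rewrite subr_ge0.
  - by rewrite gerBl.
have nd := exprn_ge0 d.-1 (ltW n_gt0).
have h5 : M ^+ 2 / 4 * (1 / 2) <= (M - a) ^+ 2 * (a ^+ 2) ^+ d.-1.
  by apply: ler_pM; rewrite ?divr_ge0 ?sqr_ge0.
apply: (@le_trans _ _
  (M ^+ 2 / 4 * (1 / 2) * (d%:R * r * (1 / 2 * n%:R ^+ d.-1)))).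
  have -> : M ^+ 2 / 4 * (1 / 2) * (d%:R * r * (1 / 2 * n%:R ^+ d.-1)) =
    d%:R * (M ^+ 2 * r) / 16 * n%:R ^+ d.-1 by field.
  rewrite many ler_wpM2r// exprMn; lra.
apply: ler_pM => //; first by rewrite mulr_ge0 ?divr_ge0 ?sqr_ge0.
by rewrite !mulr_ge0// ltW.
Qed.

End rare_values.

(** Since s^2 / n <= exp (- 40), the logarithm L is at least 40, and
p d L = s^2 / n is tiny: hence a^2 = (1 - p L) / (1 - p) is within 1 / (2 d) of
1.  The sub-Gaussian bound holds because exp L = e + n d / s^2 gives
p exp L = e p + 1 / L. *)
Lemma spike_law (R : realType) (n d : nat) (s : R)
    (L := ln (expR 1 + n%:R * d%:R / s ^+ 2)) (k := s ^+ 2 / (d%:R * L)) :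
    (0 < n)%N -> (0 < d)%N -> 0 < s -> s <= expR (- 20) * Num.sqrt n%:R ->
    d%:R <= L -> 1 <= k ->
  exists p a M : R,
    [/\ [/\ 0 <= p, p <= 1, n%:R * p = k & p * expR 32 <= 1 / 2],
        [/\ 0 <= a, a ^+ 2 <= 1, 2 * a <= M, M ^+ 2 = L &
            (1 - p) * a ^+ 2 + p * M ^+ 2 = 1],
        (1 - p) * expR (a ^+ 2 / 2 ^+ 2) + p * expR (M ^+ 2 / 2 ^+ 2) <= 2,
        d%:R * (1 - a ^+ 2) <= 1 / 2 & 40 <= L /\ 41 * s ^+ 2 <= n%:R].
Proof.
move=> n0 d0 s0 s_le dL k1.
have k0 : 0 <= k := le_trans ler01 k1.
have nR : 0 < n%:R :> R by rewrite ltr0n.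
have d1 : 1 <= d%:R :> R by rewrite ler1n.
have s2 : 0 < s ^+ 2 by rewrite exprn_gt0.
have dL0 : 0 < d%:R * L by rewrite mulr_gt0//; lra.
have kE : k * (d%:R * L) = s ^+ 2 by rewrite /k divfK ?gt_eqF.
have sn : s ^+ 2 <= expR (- 40) * n%:R.
  have -> : expR (- 40) = expR (- 20) ^+ 2 :> R.
    by rewrite -expRM_natl; congr expR; ring.
  rewrite -[n%:R]sqr_sqrtr// -exprMn; apply: lerXn2r; rewrite ?nnegrE.
  - exact: ltW.
  - by rewrite mulr_ge0 ?expR_ge0 ?sqrtr_ge0.
  - exact: s_le.
have e40 : expR (- 40) <= 1 / 41 :> R.
  rewrite expRN mul1r lef_pV2 ?posrE ?expR_gt0//.
  by apply: le_trans (expR_ge1Dx _); lra.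
have sn41 : 41 * s ^+ 2 <= n%:R.
  have := ler_wpM2r (ltW nR) e40; lra.
have L40 : 40 <= L.
  rewrite -[leLHS]expRK /L ler_ln ?posrE ?expR_gt0//; last first.
    by rewrite addr_gt0 ?expR_gt0// divr_gt0// mulr_gt0// ltr0n.
  apply: ler_wpDl; first exact: expR_ge0.
  rewrite ler_pdivlMr//; apply: (@le_trans _ _ n%:R).
    by move: sn; rewrite expRN ler_pdivlMl ?expR_gt0.
  by rewrite ler_peMr// ltW.
pose p := k / n%:R.
have np : n%:R * p = k by rewrite /p mulrC divfK ?gt_eqF.
have p0 : 0 <= p by rewrite divr_ge0// ltW.
have pdL : p * (d%:R * L) * n%:R = s ^+ 2 by rewrite -kE -np; ring.
have pdL_le : p * (d%:R * L) <= expR (- 40).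
  by rewrite -(ler_pM2r nR) pdL.
have dL40 : 40 <= d%:R * L by apply: (le_trans L40); rewrite ler_peMl//; lra.
have pL_le : p * L <= p * (d%:R * L).
  by rewrite ler_wpM2l// ler_peMl//; lra.
have p40 : 40 * p <= p * (d%:R * L) by rewrite mulrC ler_wpM2l.
have p_le1 : p <= 1 by lra.
have pe32 : p * expR 32 <= 1 / 2.
  have h : p * expR 32 <= expR (- 40) * expR 32.
    by rewrite ler_wpM2r ?expR_ge0//; lra.
  apply: (le_trans h); rewrite -expRD (_ : - 40 + 32 = - 8); last by ring.
  rewrite expRN mul1r lef_pV2 ?posrE ?expR_gt0//.
  by apply: le_trans (expR_ge1Dx _); lra.
pose al := (1 - p * L) / (1 - p).
have p1 : 0 < 1 - p by lra.
have alE : (1 - p) * al = 1 - p * L by rewrite /al mulrC divfK ?gt_eqF.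
have al0 : 0 <= al by rewrite divr_ge0//; lra.
have al1 : al <= 1 by rewrite ler_pdivrMr// mul1r lerD2l lerN2 ler_peMr//; lra.
have al_ge : 1 - p * L <= al by rewrite -alE ler_piMl//; lra.
pose a := Num.sqrt al; pose M := Num.sqrt L.
have a0 : 0 <= a := sqrtr_ge0 _.
have M0 : 0 <= M := sqrtr_ge0 _.
have a2 : a ^+ 2 = al by rewrite sqr_sqrtr.
have M2 : M ^+ 2 = L by rewrite sqr_sqrtr//; lra.
have aM : 2 * a <= M.
  rewrite -(@ler_pXn2r _ 2) ?nnegrE ?mulr_ge0// exprMn a2 M2; lra.
have pexpL : p * expR L <= 1 / 2.
  rewrite lnK ?posrE; last first.
    by rewrite addr_gt0 ?expR_gt0// divr_gt0// mulr_gt0// ltr0n.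
  rewrite mulrDr.
  have -> : p * (n%:R * d%:R / s ^+ 2) = L^-1.
    have d_neq0 : d%:R != 0 :> R by rewrite pnatr_eq0 -lt0n.
    have L_neq0 : L != 0 by rewrite gt_eqF// (lt_le_trans _ L40).
    by rewrite /p /k; field; rewrite L_neq0 d_neq0 !gt_eqF.
  have := ler_wpM2l p0 (expR1_le4 R).
  have : L^-1 <= 40^-1 by rewrite lef_pV2 ?posrE//; lra.
  lra.
exists p, a, M; rewrite M2; split=> //.
- by split=> //; rewrite a2// alE; ring.
- have h1 : expR (a ^+ 2 / 2 ^+ 2) <= 1 + 2 * (1 / 4).
    apply: (@le_trans _ _ (expR (1 / 4))); first by rewrite ler_expR a2; lra.
    by apply: expR_le1D2; lra.
  have h3 : p * expR (L / 2 ^+ 2) <= p * expR L.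
    by rewrite ler_wpM2l// ler_expR; lra.
  have h4 : (1 - p) * expR (a ^+ 2 / 2 ^+ 2) <= expR (a ^+ 2 / 2 ^+ 2).
    by rewrite ler_piMl ?expR_ge0//; lra.
  lra.
- rewrite a2; have h : d%:R * (1 - al) <= d%:R * (p * L).
    by rewrite ler_wpM2l//; lra.
  have dpL : d%:R * (p * L) = p * (d%:R * L) by ring.
  lra.
Qed.

(** The bounds N <= 4 k and N >= 400 k give f <= 3 s n^((d-1)/2) and
f >= 5 s n^((d-1)/2) respectively. *)
Lemma spike_deviates (R : realType) (c C : R) (n d : nat) (s : R)
    (L := ln (expR 1 + n%:R * d%:R / s ^+ 2)) :
    0 < c -> c <= expR (- 20) -> 2 * expR 32 + 2 <= C ->
    (0 < n)%N -> (0 < d)%N -> 0 < s -> s <= c * Num.sqrt n%:R ->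
    d%:R <= L -> 1 <= s ^+ 2 / (d%:R * L) ->
  deviates n d 2 (c * n%:R `^ ((d%:R - 1) / 2) * s)
    (expR (- (C * (s ^+ 2 / (d%:R * L))))).
Proof.
move=> c0 c_le C_ge n0 d0 s0 s_le dL k1; rewrite powR_half_pred//.
have {}s_le : s <= expR (- 20) * Num.sqrt n%:R.
  by apply: (le_trans s_le); rewrite ler_wpM2r ?sqrtr_ge0.
have [p [a [M [[p0 p1 np pe] [a0 a1 aM M2 var1] psi2 da [L40 sn41]]]]] :=
  spike_law n0 d0 s0 s_le dL k1.
rewrite -/L in np M2 L40; move: np k1.
set k := s ^+ 2 / (d%:R * L) => np k1.
have k0 : 0 <= k := le_trans ler01 k1.
have kE : d%:R * (L * k) = s ^+ 2.
  have d_neq0 : d%:R != 0 :> R by rewrite pnatr_eq0 -lt0n.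
  have L_neq0 : L != 0 by rewrite gt_eqF// (lt_le_trans _ L40).
  by rewrite /k; field; rewrite L_neq0 d_neq0.
apply: (@two_level_deviation _ _ _ p a M 2 (a ^+ d)
  (fun j => j%:R <= 4 * k) (fun j => 400 * k <= j%:R)
  (3 * s * Num.sqrt n%:R ^+ d.-1) (5 * s * Num.sqrt n%:R ^+ d.-1)) => //.
- by apply: le_trans aM; rewrite mulr_ge0.
- have := @rare_coin_lower R n p p0 p1; rewrite np => /(_ k1); apply: le_trans.
  apply: (@le_trans _ _ (expR (- 1))).
    rewrite ler_expR lerN2 -[leLHS]mulr1 ler_pM//.
    by apply: le_trans C_ge; have := expR_ge0 (32 : R); lra.
  rewrite expRN mul1r lef_pV2 ?posrE ?expR_gt0//; exact: expR1_ge2.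
- have := @rare_coin_upper R n p p0 p1; rewrite np => /(_ k1 pe).
  apply: le_trans.
  by rewrite ler_expR lerN2 ler_wpM2r.
- move=> x S absx; have s2 := sqr_ge0 s.
  have sn8 : 8 * s ^+ 2 <= n%:R by lra.
  split=> hS.
  + apply: (cube_dist_few a0 a1 aM d0 s0 sn8 absx).
    have -> : 4 * s ^+ 2 = d%:R * (M ^+ 2 * (4 * k)) by rewrite M2 -kE; ring.
    by rewrite ler_wpM2l ?ler0n// ler_wpM2l ?sqr_ge0.
  + apply: (cube_dist_many a0 a1 aM d0 s0 sn8 absx _ hS).
    * by rewrite mulr_ge0 ?ler0n.
    * exact: da.
    * have : d%:R * (40 * k) <= d%:R * (L * k).
        by rewrite ler_wpM2l// ler_wpM2r.
      rewrite kE; lra.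
    * by rewrite M2 -kE; ring.
- have c1 : c <= 1.
    by apply: (le_trans c_le); rewrite -[leRHS]expR0 ler_expR; lra.
  have sd : 0 <= Num.sqrt n%:R ^+ d.-1 :> R by rewrite exprn_ge0 ?sqrtr_ge0.
  have -> : 2 * (c * Num.sqrt n%:R ^+ d.-1 * s) =
     c * (2 * s * Num.sqrt n%:R ^+ d.-1) by ring.
  have -> : 5 * s * Num.sqrt n%:R ^+ d.-1 - 3 * s * Num.sqrt n%:R ^+ d.-1 =
     1 * (2 * s * Num.sqrt n%:R ^+ d.-1) by ring.
  by rewrite ler_wpM2r// mulr_ge0// mulr_ge0// ltW.
Qed.

(** When the second term of the minimum is the smaller one, it is positive, and
so is L; comparing it with s^2 / d^2 then gives d <= L. *)
Theorem corollary2p4 (R : realType) :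
  exists K0 c C : R,
    [/\ 0 < K0, 0 < c & 0 < C] /\
    forall (n d : nat) (s : R),
      (1 <= n)%N -> (1 <= d)%N ->
      0 < s -> s <= c * Num.sqrt n%:R ->
      1 <= rate n d s ->
      exists (disp : measure_display) (T : measurableType disp)
             (P : probability T R) (X : 'I_n -> {RV P >-> R})
             (f : tensor_space R n d -> R),
        [/\ mutually_independent X,
            forall i, [/\ ('E_P[X i] = 0)%E,
                          ('E_P[fun w => (X i w ^+ 2)%R] = 1)%E
                        & (psi2_norm P (X i) <= K0%:E)%E],
            convex_function (E := tensor_space R n d) setT f,
            lipschitz1 f
          & forall m : R,
              ((expR (- (C * rate n d s)))%:E <=
               P [set w | (c * n%:R `^ ((d%:R - 1) / 2) * s <=
                           `|f (tens_pow d (random_vector X w)) - m|)%R])%E].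
Proof.
(* c <= exp (- 20) makes s^2 / n <= exp (- 40): this forces L >= 40 and beats
   the factor exp 32 from the second moment of exp (16 N) *)
pose c : R := expR (- 20); pose C : R := 4 * 256 ^+ 2 + 2 + 2 * expR 32.
have e32 : 0 < expR 32 :> R := expR_gt0 _.
have c0 : 0 < c := expR_gt0 _.
have c_le : c <= 1 / 512.
  have h : 6 <= expR 5 :> R by apply: le_trans (expR_ge1Dx _); lra.
  rewrite /c (_ : - 20 = - (4 * 5)); last by ring.
  rewrite expRN mul1r lef_pV2 ?posrE ?expR_gt0 ?ltr0n// expRM_natl.
  apply: (@le_trans _ _ (6 ^+ 4)); first lra.
  by apply: lerXn2r; rewrite ?nnegrE ?expR_ge0.
exists 2, c, C; split; first by split=> //; rewrite /C; lra.
move=> n d s n0 d0 s0 s_le; rewrite /rate.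
have d0R : 0 < d%:R :> R by rewrite ltr0n.
set L := ln _.
have [rate_le|rate_gt] := leP (s ^+ 2 / d%:R ^+ 2) (s ^+ 2 / (d%:R * L)).
  by move=> t1; apply: norm_deviates => //; rewrite /C; lra.
move=> k1; apply: spike_deviates => //; first by rewrite /C; lra.
rewrite -/L leNgt; apply/negP => Ld.
have L0 : 0 < L.
  rewrite ltNge; apply/negP => L_le0; move: k1; apply/negP; rewrite -ltNge.
  apply: le_lt_trans ltr01; rewrite mulr_ge0_le0 ?sqr_ge0// invr_le0.
  by rewrite mulr_ge0_le0// ltW.
move: rate_gt; rewrite ltNge => /negP; apply.
rewrite ler_wpM2l ?sqr_ge0// lef_pV2 ?posrE ?exprn_gt0 ?mulr_gt0//.
by rewrite expr2 ler_pM2l// ltW.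
Qed.
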